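(* Let $Q\ge 3$ be an integer and let $\mathscr{S}_Q^*:=\{0\}\cup\mathscr{S}_Q$, where $\mathscr{S}_Q$ is the set of $\operatorname{SL}(2,\mathbb{N})$-saturated Farey fractions of order $Q$. If $\gamma_1=a_1/q_1<\gamma_2=a_2/q_2$ (written in lowest terms with positive denominators, $0=0/1$) are consecutive elements of $\mathscr{S}_Q^*$, then $a_2q_1-a_1q_2=1$.
   Context: Let $\mathcal{S}$ be the set of matrices $\begin{pmatrix} a&b\\ c&d\end{pmatrix}\in\operatorname{SL}(2,\mathbb{Z})$ with $a\ge b\ge d\ge 1$ and $a\ge c\ge d$, and let $\mathcal{S}_Q=\{M\in\mathcal{S}:\operatorname{Tr}M\le Q\}$. The set of $\operatorname{SL}(2,\mathbb{N})$-saturated Farey fractions of order $Q$ is $\mathscr{S}_Q:=\left\{d/b:\begin{pmatrix} a&b\\ c&d\end{pmatrix}\in\mathcal{S}_Q\right\}\subset\mathbb{Q}\cap(0,1]$. *)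

(* Defs.v *)
From mathcomp Require Import all_boot all_order all_algebra.
From mathcomp Require Import classical_sets.

Set Implicit Arguments.
Unset Strict Implicit.
Unset Printing Implicit Defensive.

Import Order.TTheory GRing.Theory Num.Theory.

Local Open Scope classical_set_scope.
Local Open Scope ring_scope.

(* The entries a, b, c, d of a 2 x 2 matrix M are M 0 0, M 0 1, M 1 0, M 1 1. *)
Definition calS : set 'M[int]_2 :=
  [set M | [/\ \det M = 1,
               [&& M 0 1 <= M 0 0, M 1 1 <= M 0 1 & 1 <= M 1 1]
             & (M 1 0 <= M 0 0) && (M 1 1 <= M 1 0)]].

Definition calS_trace (Q : int) : set 'M[int]_2 :=
  calS `&` [set M | \tr M <= Q].

Definition saturated_Farey (Q : int) : set rat :=
  [set (M 1 1)%:~R / (M 0 1)%:~R | M in calS_trace Q].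

Definition saturated_Farey0 (Q : int) : set rat :=
  [set 0] `|` saturated_Farey Q.

Definition consecutive (A : set rat) (x y : rat) : Prop :=
  [/\ A x, A y, x < y & forall z, A z -> ~~ (x < z < y)].

(* Main.v *)
Require Import Defs.
From mathcomp Require Import all_boot all_order all_algebra.
From mathcomp Require Import classical_sets.
From mathcomp Require Import zify ring.

(** A fraction d/b in lowest terms lies in S_Q exactly when 0 < d <= b and
    b + d + q' <= Q, where q' is the inverse of d modulo b in [1, b], that is,
    the denominator of the left Stern-Brocot parent p'/q' of d/b.  This weight
    decreases when one passes to either parent, so the left parent L of
    gamma_2 and the right parent R of gamma_1 again lie in S_Q^*, and
    consecutiveness forces L <= gamma_1 < gamma_2 <= R.  If both outer
    inequalities were strict, gamma_1 would lie strictly between the unimodular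
    pair L, gamma_2, whence q_1 > q_2, and symmetrically q_2 > q_1.  So
    gamma_1 = L or gamma_2 = R, and the determinant is 1. *)

Import Order.TTheory GRing.Theory Num.Theory.

Local Open Scope ring_scope.

Lemma det_mx22 (R : comNzRingType) (M : 'M[R]_2) :
  \det M = M 0 0 * M 1 1 - M 0 1 * M 1 0.
Proof.
have e01 : lift 0 0 = 1 :> 'I_2 by apply: val_inj.
have e10 : lift 1 0 = 0 :> 'I_2 by apply: val_inj.
rewrite (expand_det_row _ 0) big_ord_recl big_ord1 /cofactor !det_mx11 !mxE.
by rewrite e01 e10 /= expr0 expr1 mul1r mulN1r mulrN.
Qed.

Lemma mxtrace22 (R : comNzRingType) (M : 'M[R]_2) : \tr M = M 0 0 + M 1 1.
Proof.
by rewrite /mxtrace big_ord_recl big_ord1; congr (_ + M _ _); apply: val_inj.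
Qed.

Lemma ltr_pdivz (F : numFieldType) (a b c d : int) : 0 < b -> 0 < d ->
  (a%:~R / b%:~R < c%:~R / d%:~R :> F) = (a * d < c * b).
Proof.
move=> b0 d0; rewrite ltr_pdivrMr ?ltr0z // mulrAC ltr_pdivlMr ?ltr0z //.
by rewrite -!intrM ltr_int.
Qed.

Lemma eqr_divz_coprime (F : numFieldType) (a b c d : int) :
    0 < b -> 0 < d -> coprimez a b -> coprimez c d ->
  a%:~R / b%:~R = c%:~R / d%:~R :> F -> a = c /\ b = d.
Proof.
move=> b0 d0 cab ccd /eqP.
rewrite eqr_div ?intr_eq0 ?lt0r_neq0 // -!intrM eqr_int => /eqP e.
have dvd_bd : (b %| d)%Z.
  by rewrite -(@Gauss_dvdzr _ a) 1?coprimez_sym // e dvdz_mull.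
have dvd_db : (d %| b)%Z.
  by rewrite -(@Gauss_dvdzr _ c) 1?coprimez_sym // -e dvdz_mull.
have bd : b = d.
  have : (`|b| == `|d|)%N by rewrite eqn_dvd; apply/andP.
  by move/eqP; lia.
by split=> //; apply: (mulIf (lt0r_neq0 d0)); rewrite e bd.
Qed.

Lemma coprimez_det1 (a b c d : int) : a * d - b * c = 1 -> coprimez a b.
Proof. by move=> e; apply/coprimezP; exists (d, - c) => /=; lia. Qed.

(* The residue of n modulo m in [1, m] rather than in [0, m - 1]. *)
Lemma pos_residue (n m : int) : 0 < m ->
  exists k, 1 <= n - k * m <= m.
Proof.
move=> m0; exists ((n - 1) %/ m)%Z.
have := divz_eq (n - 1) m; have := ltz_pmod (n - 1) m0.
have : 0 <= ((n - 1) %% m)%Z by rewrite modz_ge0 // lt0r_neq0.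
lia.
Qed.

(** Adding the column [(b, d)] to [(q, p)] keeps the determinant, makes the first column dominate
    the second and gives trace [b + d + q]. *)
Lemma saturated_Farey_intro (Q d b p q : int) :
    d * q - p * b = 1 -> 0 < d <= b -> 0 < q -> b + d + q <= Q ->
  saturated_Farey Q (d%:~R / b%:~R).
Proof.
move=> e hdb hq hQ.
pose M : 'M[int]_2 := \matrix_(i, j)
  if i == 0 then (if j == 0 then q + b else b)
  else (if j == 0 then p + d else d).
exists M; last by rewrite !mxE.
split; last by rewrite /= mxtrace22 !mxE /=; lia.
split=> /=; rewrite ?det_mx22 !mxE /=; nia.
Qed.

Lemma saturated_FareyP (Q : int) (x : rat) : saturated_Farey Q x ->
  exists d b p q : int, [/\ x = d%:~R / b%:~R, d * q - p * b = 1,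
    0 < d <= b, 0 < q <= b & 0 <= p /\ b + d + q <= Q].
Proof.
case=> M [[]].
rewrite /= det_mx22 mxtrace22.
set a := M 0 0; set b := M 0 1; set c := M 1 0; set d := M 1 1.
move=> e /and3P[ba db d1] /andP[ca dc] tr <-.
have [|k /andP[q1 qb]] := @pos_residue a b; first by lia.
(* If [k <= 0], then [a = b], so [b * (d - c) = 1], against [d <= c]. *)
have k1 : 1 <= k by nia.
exists d, b, (c - k * d), (a - k * b).
by split; [| lia | lia | lia | split; nia].
Qed.

Lemma left_parent_saturated (Q d b p q : int) :
    d * q - p * b = 1 -> 0 < d <= b -> 0 < q <= b -> 0 <= p ->
    b + d + q <= Q ->
  saturated_Farey0 Q (p%:~R / q%:~R).
Proof.
move=> e hd hq; rewrite le_eqVlt => /predU1P[<- _|p0 hQ].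
  by left; rewrite /= mul0r.
(* As [p * (- b)] is 1 modulo [q], the residue of [- b] is the inverse of [p]. *)
right; have [|k /andP[s1 sq]] := @pos_residue (- b) q; first by lia.
by apply: (@saturated_Farey_intro _ _ _ (- d - k * p) (- b - k * q)); nia.
Qed.

(** [d/b] is the mediant of its parents, so [p/q] also forms a unimodular pair with the right one.
    The bound [d < b] excludes [1/1], whose right parent is [1/0]. *)
Lemma right_parent_saturated (Q d b p q : int) :
    d * q - p * b = 1 -> 0 < d < b -> 0 < q <= b -> b + d + q <= Q ->
    0 <= p ->
  0 < b - q /\ saturated_Farey0 Q ((d - p)%:~R / (b - q)%:~R).
Proof.
move=> e hd hq hQ p0.
have qb : 0 < b - q.
  have [||qb] := ltgtP q b; [lia|lia|].
  have : (d - p) * b = 1 by rewrite -e qb; ring.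
  by case: (lerP (d - p) 0); nia.
split=> //; right.
have pd : p < d by nia.
by apply: (@saturated_Farey_intro _ _ _ p q); nia.
Qed.

(** In the basis [(p, q)], [(a2, q2)] the vector [(a1, q1)] has coordinates [D > 0] and [u >= 0]. If
    [u = 0], primitivity gives [D = 1]; otherwise [q1 >= q + q2]. *)
Lemma det1_or_denom_lt (a1 q1 a2 q2 p q : int) :
    0 < q2 -> 0 < q -> coprimez a1 q1 ->
    a2 * q - p * q2 = 1 -> a1 * q2 < a2 * q1 -> p * q1 <= a1 * q ->
  a2 * q1 - a1 * q2 = 1 \/ q2 < q1.
Proof.
move=> q20 q0 /coprimezP[[x y] /= cop] e lt12 le1.
pose D := a2 * q1 - a1 * q2; pose u := a1 * q - p * q1.
have D0 : 0 < D by rewrite subr_gt0.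
(* Cramer's rule in the basis (p, q), (a2, q2) of the lattice. *)
have q1E : q1 = D * q + u * q2.
  transitivity (q1 * (a2 * q - p * q2)); first by rewrite e mulr1.
  by rewrite /D /u; ring.
have a1E : a1 = D * p + u * a2.
  transitivity (a1 * (a2 * q - p * q2)); first by rewrite e mulr1.
  by rewrite /D /u; ring.
have : 0 <= u by rewrite subr_ge0.
rewrite le_eqVlt => /predU1P[u0|u0]; last by right; nia.
left; rewrite -/D; move: q1E a1E cop.
rewrite -u0 !mul0r !addr0 => -> -> cop.
have : D * (x * p + y * q) = 1 by rewrite -cop; ring.
move: D0 (x * p + y * q); clear; move: D => D D0 X DX1.
by case: (lerP X 0); nia.
Qed.

Lemma consecutive_le (A : set rat) (x y z : rat) :
  consecutive A x y -> A z -> z < y -> z <= x.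
Proof.
case=> _ _ _ gap Az zy; rewrite leNgt; apply/negP => xz.
by have := gap z Az; rewrite xz zy.
Qed.

Lemma consecutive_ge (A : set rat) (x y z : rat) :
  consecutive A x y -> A z -> x < z -> y <= z.
Proof.
case=> _ _ _ gap Az xz; rewrite leNgt; apply/negP => zy.
by have := gap z Az; rewrite xz zy.
Qed.

Theorem propositionA2 (Q : int) (a1 q1 a2 q2 : int)
    (hQ : 3 <= Q)
    (hq1 : 0 < q1) (hq2 : 0 < q2)
    (h1 : coprimez a1 q1) (h2 : coprimez a2 q2)
    (hcons : consecutive (saturated_Farey0 Q)
               (a1%:~R / q1%:~R) (a2%:~R / q2%:~R)) :
  a2 * q1 - a1 * q2 = 1.
Proof.
have [S1 S2 lt12 _] := hcons; rewrite ltr_pdivz // in lt12.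
have a1_ge0 : 0 <= a1.
  case: S1 => /= [/eqP|/saturated_FareyP[d [b [p [q [E e hd hq _]]]]]].
    by rewrite mulf_eq0 invr_eq0 !intr_eq0; lia.
  have [|//|->] := @eqr_divz_coprime _ _ _ _ _ hq1 _ h1 _ E; last by lia.
    by lia.
  by apply: (@coprimez_det1 _ _ p q); lia.
have a2_gt0 : 0 < a2 by nia.
case: S2 => /= [/eqP|/saturated_FareyP[d [b [p [q [E e hd hq [p0 hw]]]]]]].
  by rewrite mulf_eq0 invr_eq0 !intr_eq0; lia.
have [||da2 bq2] := @eqr_divz_coprime _ _ _ _ _ hq2 _ h2 _ E; first by lia.
  by apply: (@coprimez_det1 _ _ p q); lia.
subst d b.
have le_L : p * q1 <= a1 * q.
  have SL := left_parent_saturated _ _ _ _ _ e hd hq p0 hw.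
  have /(consecutive_le _ _ _ _ hcons SL) : p%:~R / q%:~R < a2%:~R / q2%:~R :> rat.
    by rewrite ltr_pdivz; lia.
  by rewrite leNgt ltr_pdivz -?leNgt //; lia.
have [|//|lt_q21] := @det1_or_denom_lt a1 q1 a2 q2 p q hq2 _ h1 e lt12 le_L.
  by lia.
(* The fraction [0/1] is ruled out by [q1 > q2 >= 1]. *)
case: S1 => /= [/eqP|].
  rewrite mulf_eq0 invr_eq0 !intr_eq0 => a10.
  have {}a10 : a1 = 0 by lia.
  by move: h1; rewrite a10 /coprimez gcd0z; lia.
move=> /saturated_FareyP[d [b [r [s [E1 e1 hd1 hs [r0 hw1]]]]]].
have [||da1 bq1] := @eqr_divz_coprime _ _ _ _ _ hq1 _ h1 _ E1; first by lia.
  by apply: (@coprimez_det1 _ _ r s); lia.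
subst d b.
have [|bs SR] := right_parent_saturated _ _ _ _ _ e1 _ hs hw1 r0; first by nia.
have le_R : a2 * (q1 - s) <= (a1 - r) * q2.
  have /(consecutive_ge _ _ _ _ hcons SR) :
      a1%:~R / q1%:~R < (a1 - r)%:~R / (q1 - s)%:~R :> rat.
    by rewrite ltr_pdivz //; lia.
  by rewrite leNgt ltr_pdivz -?leNgt.
(* Negating fractions reverses the order and turns the right parent into a left one; the alternative
   [q1 < q2] contradicts [lt_q21]. *)
have := @det1_or_denom_lt (- a2) q2 (- a1) q1 (r - a1) (q1 - s) hq1 bs.
rewrite coprimeNz => /(_ h2); lia.
Qed.
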